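(* Let $K_{n_1,n_2,\ldots,n_r}^{r}$ be a complete $r$-partite $r$-uniform hypergraph, and let $C_\tau$ denote the transversal coalition number. Then $$r\leq C_\tau(K_{n_1,n_2,\ldots,n_r}^{r})\leq 2r.$$
   Context: A hypergraph $H=(U,\mathcal{E})$ consists of a finite vertex set $U$ and a family $\mathcal{E}$ of subsets of $U$ called (hyper)edges; it is $r$-uniform if every edge has exactly $r$ vertices. The complete $r$-partite $r$-uniform hypergraph $K^r_{n_1,\dots,n_r}$ has vertex set $U=U_1\cup U_2\cup\cdots\cup U_r$, where the $U_i$ are pairwise disjoint nonempty sets with $|U_i|=n_i$, and edge set $\mathcal{E}=\{\{u_1,u_2,\ldots,u_r\} : u_i\in U_i \text{ for } i=1,\dots,r\}$, i.e. the edges are exactly the sets containing exactly one vertex from each part. A transversal of $H$ is a set $T\subseteq U$ with $T\cap e\neq\emptyset$ for every $e\in\mathcal{E}$. Two disjoint sets $A,B\subseteq U$ form a transversal coalition if neither $A$ nor $B$ is a transversal of $H$ but $A\cup B$ is a transversal of $H$. A transversal coalition partition of $H$ is a partition $\varphi=\{P_1,\dots,P_k\}$ of $U$ into nonempty sets such that each $P_i$ either is a singleton that is a transversal of $H$, or is not a transversal of $H$ and forms a transversal coalition with some other (non-transversal) set $P_j\in\varphi$. The transversal coalition number $C_\tau(H)$ is the maximum $k$ for which $H$ has a transversal coalition partition with $k$ parts. *)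

(* Defs.v *)
From mathcomp Require Import all_boot.

Set Implicit Arguments.
Unset Strict Implicit.
Unset Printing Implicit Defensive.

Record hypergraph := Hypergraph {
  vertex : finType;
  edges : {set {set vertex}}
}.

Definition complete_partite_edges (V : finType) (r : nat)
    (U : 'I_r -> {set V}) : {set {set V}} :=
  [set [set u i | i : 'I_r] | u : {ffun 'I_r -> V} & [forall i, u i \in U i]].

(* [H] is a copy of K^r_{n_0, ..., n_(r-1)}: the classes [U i] are existentially
   quantified, so the vertices may be of any finite type. *)
Definition is_complete_partite (r : nat) (n : 'I_r -> nat)
    (H : hypergraph) : Prop :=
  exists U : 'I_r -> {set vertex H},
    [/\ \bigcup_i U i = [set: vertex H],
        forall i j, i != j -> [disjoint U i & U j],
        forall i, U i != set0,
        forall i, #|U i| = n i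
      & edges H = complete_partite_edges U].

Section TransversalCoalition.
Variable H : hypergraph.
Implicit Types (A B T : {set vertex H}) (P : {set {set vertex H}}).

Definition transversal T : bool := [forall e in edges H, T :&: e != set0].

Definition transversal_coalition A B : bool :=
  [&& [disjoint A & B], ~~ transversal A, ~~ transversal B
    & transversal (A :|: B)].

(* [partition] requires the blocks to be nonempty. *)
Definition transversal_coalition_partition P : bool :=
  partition P [set: vertex H] &&
  [forall A in P,
     (#|A| == 1) && transversal A
     || ~~ transversal A && [exists B in P :\ A, transversal_coalition A B]].

(* The value is 0 if [H] has no transversal coalition partition. *)
Definition transversal_coalition_number : nat :=
  \max_(P : {set {set vertex H}} | transversal_coalition_partition P) #|P|.

End TransversalCoalition.

(* Main.v *)
Require Import Defs.
From mathcomp Require Import all_boot.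
(* [finset] also defines a [transversal]: the one of [Defs] must come last. *)
Import Defs.

(** A set is a transversal iff it contains a whole class. For the lower bound,
    cut each class [U i] into a singleton and the (possibly empty) rest: the two
    pieces are coalition partners, or the singleton is the class. For the upper
    bound, each block, with its partner if it has one, covers a class which it
    meets; a class covered by two blocks meets no third one, so at most two
    blocks are charged to each of the [r] classes. *)

Section CompletePartite.
Variables (r : nat) (H : hypergraph) (U : 'I_r -> {set vertex H}).
Hypothesis U_cover : \bigcup_i U i = [set: vertex H].
Hypothesis U_disjoint : forall i j, i != j -> [disjoint U i & U j].
Hypothesis U_neq0 : forall i, U i != set0.
Hypothesis edgesE : edges H = complete_partite_edges U.
Implicit Types (A T : {set vertex H}) (P : {set {set vertex H}}).

Lemma class_inj i j x : x \in U i -> x \in U j -> i = j.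
Proof.
move=> xi xj; apply/eqP; apply: contraT => /U_disjoint/disjointFr/(_ xi).
by rewrite xj.
Qed.

(** If no class lies inside [T], picking in each class a vertex outside [T] produces an edge that
    misses [T]. *)
Lemma transversalP T : reflect (exists i, U i \subset T) (transversal T).
Proof.
apply: (iffP forall_inP) => [trT | [i UiT] e]; last first.
  rewrite edgesE => /imsetP[u]; rewrite inE => /forallP uU ->.
  apply/set0Pn; exists (u i); rewrite inE (subsetP UiT) ?uU //=.
  exact: imset_f.
apply/existsP; apply: contraT => /existsPn noU.
have /fin_all_exists[u uP] i : exists x, x \in U i :\: T.
  by have /subsetPn[x xU xT] := noU i; exists x; rewrite inE xT.
have /trT/set0Pn[x /setIP[xT /imsetP[i _ xE]]] :
    [set finfun u i | i : 'I_r] \in edges H.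
  rewrite edgesE; apply: imset_f; rewrite inE; apply/forallP => i.
  by have /setDP[] := uP i; rewrite ffunE.
by have /setDP[_] := uP i; rewrite -(ffunE u) -xE xT.
Qed.

Lemma coalition_partition_card P :
  transversal_coalition_partition P -> #|P| <= 2 * r.
Proof.
case/andP=> partP /forall_inP coalP.
have /and3P[_ trivP _] := partP.
have inj_block A B x : A \in P -> B \in P -> x \in A -> x \in B -> A = B.
  by move=> AP BP xA xB; rewrite -(def_pblock trivP AP xA) (def_pblock trivP BP xB).
pose charged i := [set A in P | (A :&: U i != set0) &&
                     [exists B in P, U i \subset A :|: B]].
have sub_charged : P \subset \bigcup_i charged i.
  apply/subsetP => A AP; apply/bigcupP.
  have /orP[/andP[_ /transversalP[i UiA]] | ] := coalP A AP.
    exists i => //; rewrite inE AP (setIidPr UiA) U_neq0 /=.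
    (* A transversal singleton has no partner, so it is paired with itself; [charged] does not ask
       for [B] to differ from [A]. *)
    by apply/exists_inP; exists A; rewrite // setUid.
  case/andP=> _ /exists_inP[B /setD1P[_ BP]].
  case/and4P=> _ _ ntB /transversalP[i UiAB].
  exists i => //; rewrite inE AP /=; apply/andP; split; last first.
    by apply/exists_inP; exists B.
  (* If [A] missed [U i], then [B] alone would contain [U i] and be a transversal. *)
  apply: contraNneq ntB => AUi0; apply/transversalP; exists i.
  by rewrite -(setIidPr UiAB) setIUl AUi0 set0U subsetIl.
have charged_le2 i : #|charged i| <= 2.
  have [-> | [A]] := set_0Vmem (charged i); first by rewrite cards0.
  rewrite inE => /and3P[AP _ /exists_inP[B BP UiAB]].
  apply: leq_trans (_ : #|[set A; B]| <= 2); last by rewrite cards2; case: eqP.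
  (* A block meeting [U i] shares a vertex with [A] or [B], hence equals it. *)
  apply/subset_leq_card/subsetP => C; rewrite !inE => /and3P[CP CUi _].
  have /set0Pn[x /setIP[xC /(subsetP UiAB)/setUP[xA | xB]]] := CUi.
    by rewrite (inj_block _ _ _ CP AP xC xA) eqxx.
  by rewrite (inj_block _ _ _ CP BP xC xB) eqxx orbT.
apply: leq_trans (subset_leq_card sub_charged) _.
have -> : 2 * r = \sum_(i < r) 2 by rewrite sum_nat_const card_ord mulnC.
apply: (big_ind2 (fun (X : {set {set vertex H}}) m => #|X| <= m)) => //.
- by rewrite cards0.
- move=> X m Y p Xm Yp; apply: leq_trans (leq_add Xm Yp).
  by rewrite cardsU leq_subr.
Qed.

Lemma exists_coalition_partition :
  exists2 P, transversal_coalition_partition (H := H) P & r <= #|P|.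
Proof.
have /fin_all_exists[a aU] i : exists x, x \in U i by apply/set0Pn.
have /fin_all_exists[cl clP] x : exists i, x \in U i.
  have : x \in \bigcup_i U i by rewrite U_cover.
  by case/bigcupP=> i _ xU; exists i.
have cla i : cl (a i) = i by apply: class_inj (clP _) (aU i).
(* The pieces are the fibres of [f], so an empty rest never occurs as a block. *)
pose f x := (cl x, x == a (cl x)).
pose block x := [set y in [set: vertex H] | f x == f y].
have memB x y : (y \in block x) = (f x == f y) by rewrite !inE.
have blockP x : block x \in preim_partition f [set: vertex H].
  exact: imset_f.
have block_a i : block (a i) = [set a i].
  apply/setP => y; rewrite memB !inE xpair_eqE cla eqxx.
  by apply/andP/eqP => [[/eqP <- /eqP/esym/eqP] | ->]; rewrite ?cla ?eqxx.
exists (preim_partition f [set: vertex H]); last first.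
  rewrite -[leqLHS]card_ord -(card_imset _ (f := block \o a)); last first.
    by move=> i j /=; rewrite !block_a => /set1_inj E; rewrite -(cla i) E cla.
  by apply/subset_leq_card/subsetP => _ /imsetP[i _ ->]; apply: blockP.
rewrite /transversal_coalition_partition preim_partitionP /=.
apply/forall_inP => _ /imsetP[x _ ->]; rewrite -/(block x).
(* As [a (cl x)] lies in the class of [x], [f] is constant on that class exactly when the class is a
   single vertex. *)
have [singl | /forall_inPn[y yU yx]] :=
    boolP [forall y in U (cl x), f x == f y].
  have fxa : f x = f (a (cl x)) by apply/eqP/(forall_inP singl)/aU.
  apply/orP; left; apply/andP; split.
    have -> : block x = block (a (cl x)).
      by apply/setP => y; rewrite !memB fxa.
    by rewrite block_a cards1.
  apply/transversalP; exists (cl x); apply/subsetP => y yU.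
  by rewrite memB (forall_inP singl).
have cly : cl y = cl x := class_inj _ _ _ (clP y) yU.
(* A block stays inside one class, the only one it could contain; [w] is a vertex of that class
   outside it. *)
have ntr z w : cl w = cl z -> f z != f w -> ~~ transversal (block z).
  move=> clw zw; apply/transversalP => -[i /subsetP Uiz].
  have iz : i = cl z.
    by have := Uiz _ (aU i); rewrite memB => /eqP[-> _]; rewrite cla.
  by have := Uiz w; rewrite memB (negPf zw) iz -clw clP => /(_ isT).
apply/orP; right; rewrite (ntr x y) //=.
apply/exists_inP; exists (block y).
  rewrite in_setD1 blockP andbT.
  by apply: contraNneq yx => E; rewrite -memB -E memB.
apply/and4P; split.
- rewrite -setI_eq0; apply: contraNT yx => /set0Pn[z].
  by rewrite inE !memB => /andP[/eqP -> /eqP ->].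
- exact: ntr yx.
- by apply: (ntr y x); rewrite // eq_sym.
apply/transversalP; exists (cl x); apply/subsetP => z zU.
have clz : cl z = cl x := class_inj _ _ _ (clP z) zU.
move: yx; rewrite in_setU !memB /f clz cly !xpair_eqE !eqxx /=.
(* On one class [f] takes at most two values, and [x] and [y] realize both, so [z] agrees with one
   of them. *)
by case: (x == _) (y == _) (z == _) => [] [] [].
Qed.

End CompletePartite.

Theorem theorem5 (r : nat) (n : 'I_r -> nat) (H : hypergraph)
    (hH : is_complete_partite n H) :
  r <= transversal_coalition_number H <= 2 * r.
Proof.
have [U [U_cover U_disjoint U_neq0 _ edgesE]] := hH.
apply/andP; split; last first.
  by apply/bigmax_leqP => P; apply: (@coalition_partition_card r H U).
have [P coalP rP] :=
  exists_coalition_partition _ _ _ U_cover U_disjoint U_neq0 edgesE.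
by apply: leq_trans rP _; apply: leq_bigmax_cond.
Qed.
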